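(* Let $\{\mathbf{A}_1,\mathbf{A}_2,\dots,\mathbf{A}_K\}$ be a sequence of fixed Hermitian positive semi-definite matrices in $\mathbb{C}^{d\times d}$, invertible so that the negative powers $\mathbf{A}_k^{-\alpha}$ below are defined, and let $\{x_1,x_2,\dots,x_K\}$ be a finite sequence of independent real random variables. Suppose there exist constants $C>0$ and $\alpha>0$ such that $$\mathbb{E}\,e^{-\theta x_k}\leq C\cdot\theta^{-\alpha}\qquad\text{for all }\theta>0\text{ and all }k=1,\dots,K.$$ Let $$\nu=\lambda_{\max}\Big(\sum_{k=1}^K\mathbf{A}_k^{-\alpha}\Big),\qquad \nu_k=\lambda_{\max}(\mathbf{A}_k^{-\alpha}).$$ Then for any $0<\epsilon<\frac{K\alpha}{e}\cdot\big(\frac{K}{C\nu}\big)^{1/\alpha}$, $$\mathbb{P}\Big\{\lambda_{\max}\Big(\sum_{k=1}^Kx_k\mathbf{A}_k\Big)\leq\epsilon\Big\}\leq\Big(\frac{e\,\epsilon}{K\alpha}\Big)^{\alpha K}\cdot\Big(\frac{C\nu}{K}\Big)^K.$$ Furthermore, for any $0<\epsilon<\frac{\alpha}{e}\cdot C^{-\frac1\alpha}\cdot\big(\prod_{k=1}^K\nu_k\big)^{-\frac{1}{\alpha K}}$, $$\mathbb{P}\Big\{\lambda_{\max}\Big(\sum_{k=1}^Kx_k\mathbf{A}_k\Big)\leq\epsilon\Big\}\leq\Big(\prod_{k=1}^K\nu_k\Big)\cdot C^K\cdot\Big(\frac{e\,\epsilon}{\alpha}\Big)^{K\alpha}.$$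
   Context: For a Hermitian matrix $\mathbf{A}$, $\lambda_{\max}(\mathbf{A})$ denotes its largest eigenvalue. Powers $\mathbf{A}^{-\alpha}$ are defined by the spectral functional calculus: if $\mathbf{A}=\mathbf{U}\Lambda\mathbf{U}^*$ with $\mathbf{U}$ unitary and $\Lambda$ real diagonal, then $f(\mathbf{A})=\mathbf{U}f(\Lambda)\mathbf{U}^*$, with $f$ applied to the diagonal entries. Here $e$ is the base of the natural logarithm. *)

(* Defs.v *)
From HB Require Import structures.
From mathcomp Require Export all_boot all_order all_algebra.
From mathcomp Require Export sesquilinear spectral.
From mathcomp Require Export complex.
From mathcomp Require Export all_classical all_reals all_analysis.

Set Implicit Arguments.
Unset Strict Implicit.
Unset Printing Implicit Defensive.

Import Order.TTheory GRing.Theory Num.Theory.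
Local Open Scope classical_set_scope.
Local Open Scope ring_scope.
Local Open Scope complex_scope.
Local Open Scope sesquilinear_scope.

(* The order on R[i] makes [0 <= z] mean that z is real and nonnegative. *)
Definition psdmx (R : realType) (d : nat) (A : 'M[R[i]]_d) : Prop :=
  A \is hermsymmx /\ forall u : 'cV[R[i]]_d, 0 <= (u ^t* *m A *m u) 0 0.

(* For Hermitian A of positive size the set is finite and nonempty, so the
   supremum is its largest element: see [lambda_maxP]. *)
Definition lambda_max (R : realType) (d : nat) (A : 'M[R[i]]_d) : R :=
  sup [set r : R | eigenvalue A r%:C].

(* [spectralmx A] is U^* in the decomposition A = U diag U^*.  For Hermitian A
   the diagonal is real, so [Re] loses nothing, and the result does not depend
   on the decomposition chosen by the library: see [hermfunE]. *)
Definition hermfun (R : realType) (d : nat) (f : R -> R) (A : 'M[R[i]]_d) :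
    'M[R[i]]_d :=
  let P := spectralmx A in
  P ^t* *m diag_mx (map_mx (fun z => (f (complex.Re z))%:C) (spectral_diag A))
    *m P.

Definition hermpow (R : realType) (d : nat) (A : 'M[R[i]]_d) (a : R) :
    'M[R[i]]_d := hermfun (fun t => t `^ a) A.

Definition mutually_independent (disp : measure_display)
    (T : measurableType disp) (R : realType) (P : probability T R)
    (I : finType) (X : I -> {RV P >-> R}) : Prop :=
  forall (J : {set I}) (B : I -> set R), (forall i, measurable (B i)) ->
    P (\bigcap_(i in [set i | i \in J]) (X i @^-1` B i)) =
    (\prod_(i in J) P (X i @^-1` B i))%E.

Lemma hermfunE (R : realType) (d : nat) (f : R -> R) (U : 'M[R[i]]_d)
    (l : 'rV[R]_d) : U \is unitarymx ->
  hermfun f (U *m diag_mx (map_mx (fun x => x%:C) l) *m U ^t*) =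
  U *m diag_mx (map_mx (fun x => (f x)%:C) l) *m U ^t*.
Proof.
move=> Uu; set A := (X in hermfun f X); set L := map_mx (fun x => x%:C) l.
have UU : U ^t* *m U = 1%:M.
  have Uu' : U ^t* \is unitarymx by rewrite trmxC_unitary.
  by move/unitarymxP: Uu'; rewrite trmxCK.
have UUt : U *m U ^t* = 1%:M by exact/unitarymxP.
have An : A \is normalmx.
  apply/orthomx_spectral_subproof; exists (U ^t*, L) => /=.
    by rewrite trmxC_unitary.
  by rewrite invmx_unitary ?trmxC_unitary// trmxCK.
rewrite /hermfun; set P := spectralmx A; set D := spectral_diag A.
have Pu : P \is unitarymx by exact: spectral_unitarymx.
have PPt : P *m P ^t* = 1%:M by exact/unitarymxP.
have PP : P ^t* *m P = 1%:M.
  have Pu' : P ^t* \is unitarymx by rewrite trmxC_unitary.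
  by move/unitarymxP: Pu'; rewrite trmxCK.
have AE : A = P ^t* *m diag_mx D *m P.
  by rewrite -invmx_unitary//; exact/orthomx_spectralP.
have DW : diag_mx D *m (P *m U) = (P *m U) *m diag_mx L.
  have : P *m A *m U = P *m A *m U by [].
  rewrite {1}AE /A !mulmxA PPt mul1mx -!mulmxA UU mulmx1 => ->.
  by rewrite !mulmxA.
have fW : diag_mx (map_mx (fun z => (f (complex.Re z))%:C) D) *m (P *m U) =
    (P *m U) *m diag_mx (map_mx (fun x => (f x)%:C) l).
  move: (P *m U) DW => W /matrixP DW; apply/matrixP => i j.
  have := DW i j; rewrite !mul_diag_mx !mul_mx_diag !mxE.
  have [->|W0] := eqVneq (W i j) 0; first by rewrite !mulr0 !mul0r.
  by rewrite mulrC => /(mulfI W0) ->; rewrite mulrC.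
have -> : P ^t* *m diag_mx (map_mx (fun z => (f (complex.Re z))%:C) D) *m P =
    P ^t* *m (diag_mx (map_mx (fun z => (f (complex.Re z))%:C) D)
      *m (P *m U)) *m U ^t*.
  by rewrite -!mulmxA UUt mulmx1.
by rewrite fW !mulmxA PP mul1mx.
Qed.

Lemma lambda_maxP (R : realType) (d : nat) (A : 'M[R[i]]_d) :
  (0 < d)%N -> A \is hermsymmx ->
  eigenvalue A (lambda_max A)%:C /\
  forall a : R[i], eigenvalue A a -> a <= (lambda_max A)%:C.
Proof.
move=> d0 Ah.
have AE : A = invmx (spectralmx A) *m diag_mx (spectral_diag A)
    *m spectralmx A by exact/orthomx_spectralP/hermitian_normalmx.
have Dr := hermitian_spectral_diag_real Ah.
set D := spectral_diag A in AE Dr; set P := spectralmx A in AE.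
have Pu : P \in unitmx by exact: spectral_unit.
have DRe i : D 0 i = (complex.Re (D 0 i))%:C.
  by rewrite RRe_real//; exact: (mxOverP Dr).
have PA : P *m A = diag_mx D *m P by rewrite AE !mulmxA mulmxV// mul1mx.
have eigD i : eigenvalue A (D 0 i).
  apply/eigenvalueP; exists (row i P).
    rewrite -row_mul PA; apply/rowP => j; rewrite !(mxE, mul_diag_mx).
    by rewrite mulrC.
  apply/eqP => ri; have : row i P *m invmx P = 0 by rewrite ri mul0mx.
  rewrite -row_mul mulmxV// => /rowP/(_ i); rewrite !mxE eqxx => /eqP.
  by rewrite oner_eq0.
have Deig a : eigenvalue A a -> exists i, a = D 0 i.
  move=> /eigenvalueP[v vA v0]; set w := v *m invmx P.
  have wP : w *m P = v by rewrite /w mulmxKV.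
  have w0 : w != 0 by apply: contra_neq v0 => w0; rewrite -wP w0 mul0mx.
  have wD : w *m diag_mx D = a *: w.
    by rewrite /w scalemxAl -vA AE !mulmxA mulmxK.
  have [i wi] : exists i, w 0 i != 0.
    apply/existsP; apply: contraNT w0; rewrite negb_exists => /forallP h.
    apply/eqP/rowP => i; rewrite [RHS]mxE; apply/eqP.
    by have := h i; rewrite negbK.
  exists i; move: w wi wD {wP w0} => w wi /rowP/(_ i).
  by rewrite mul_mx_diag !mxE mulrC => /(mulIf wi).
pose i0 : 'I_d := Ordinal d0.
have [m _ mP] := arg_maxP (fun i => complex.Re (D 0 i)) (erefl : xpredT i0).
have lE : lambda_max A = complex.Re (D 0 m).
  apply/eqP; rewrite eq_le; apply/andP; split.
    apply: ge_sup; first by exists (complex.Re (D 0 m)); rewrite /= -DRe.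
    by move=> r /= /Deig[i ri]; have := mP i isT; rewrite -ri.
  apply: ub_le_sup; last by rewrite /= -DRe.
  exists (complex.Re (D 0 m)) => r /= /Deig[i ri].
  by have := mP i isT; rewrite -ri.
rewrite lE; split; first by rewrite -DRe.
by move=> a /Deig[i ->]; rewrite (DRe i) lecR; exact: mP.
Qed.

(* Main.v *)
Require Import Defs.
From mathcomp Require Import measurable_fun_approximation measurable_realfun.
From mathcomp Require Import ring lra.

(** The bound comes from testing the random matrix [M = \sum_k x_k A_k] on a
single unit vector, which reduces it to a scalar Chernoff bound.

Take the first basis vector and let [a_k] be the corresponding diagonal entry of
[A_k], a positive real.  A diagonal entry of a Hermitian matrix is a convex
combination of its eigenvalues, so [lambda_max M] is at least [\sum_k a_k x_k]
([diag_le_lambda_max]), and the event is contained in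
[\sum_k a_k x_k <= eps].  Bounding the indicator of this half-space by
[expR (theta * (eps - \sum_k a_k x_k))], factoring the expectation by
independence ([indep_integral_prod]), using the hypothesis on the Laplace
transforms and choosing [theta = K * alpha / eps] give
([prob_weighted_sum_le])

  [(e * eps / (K * alpha)) `^ (alpha * K) * C ^+ K * \prod_k a_k `^ (- alpha)].

The function [t `^ (- alpha)] is convex and the same convex weights express the
diagonal entries of [A_k] and of its power, so by Jensen
[a_k `^ (- alpha)] is at most the diagonal entry of [hermpow A_k (- alpha)]
([diag_hermpow_jensen]), hence at most [nu_k].  The second bound follows at
once, even with the extra factor [K] in the denominator of the base.  For the
first, the inequality of arithmetic and geometric means bounds the product by
the [K]-th power of [K^-1 * \sum_k a_k `^ (- alpha)]; the sum is at most a
diagonal entry of [\sum_k hermpow A_k (- alpha)], hence at most [nu].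

The inclusion of events gives an inequality of probabilities only once
[lambda_max M <= eps] is known to be measurable.  This is obtained by
rewriting it as countably many inequalities on determinants
([lambda_max_leP], [measurable_lambda_max_le]). *)

Set Implicit Arguments.
Unset Strict Implicit.
Unset Printing Implicit Defensive.

Import Order.TTheory GRing.Theory Num.Theory.
Import numFieldNormedType.Exports.
Local Open Scope classical_set_scope.
Local Open Scope ring_scope.
Local Open Scope complex_scope.
Local Open Scope sesquilinear_scope.

(** * Convexity of negative powers *)

Section Convexity.
Variable R : realType.

(** A convex function lies above its tangent line at [a].  By homogeneity this
reduces to [t = a * s] with [a] factored out, where two uses of
[1 + u <= expR u] suffice: one bounds [s `^ (- alpha)] below by
[1 - alpha * ln s], the other gives [ln s <= s - 1]. *)
Lemma powR_tangent (alpha a t : R) : 0 < alpha -> 0 < a -> 0 < t ->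
  a `^ (- alpha) * (1 - alpha * (t / a - 1)) <= t `^ (- alpha).
Proof.
move=> al0 a0 t0; have ta0 : 0 < t / a by rewrite divr_gt0.
have {2}-> : t = a * (t / a) by rewrite mulrCA mulfV ?mulr1// gt_eqF.
rewrite (powRM _ (ltW a0) (ltW ta0)) ler_wpM2l ?powR_ge0//.
rewrite /powR (gt_eqF ta0); apply: le_trans (expR_ge1Dx _).
rewrite lerD2l mulNr lerN2 (ler_wpM2l (ltW al0))//.
rewrite -ler_expR lnK ?posrE//; apply: le_trans (expR_ge1Dx _).
by rewrite addrCA subrr addr0.
Qed.

Lemma convex_comb_gt0 (I : finType) (w t : I -> R) :
  (forall i, 0 <= w i) -> \sum_i w i = 1 -> (forall i, 0 < t i) ->
  0 < \sum_i w i * t i.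
Proof.
move=> w0 w1 t0; rewrite lt_neqAle eq_sym; apply/andP; split; last first.
  by apply: sumr_ge0 => i _; rewrite mulr_ge0// ltW.
apply/negP; rewrite psumr_eq0 => [/allP h|i _]; last by rewrite mulr_ge0// ltW.
move: w1; rewrite big1 => [/eqP|i _]; first by rewrite eq_sym oner_eq0.
by have := h i (mem_index_enum i); rewrite mulf_eq0 (gt_eqF (t0 i)) orbF => /eqP.
Qed.

(** Averaging the tangent line at the mean [a] kills its linear term. *)
Lemma powR_jensen (I : finType) (w t : I -> R) (alpha : R) : 0 < alpha ->
  (forall i, 0 <= w i) -> \sum_i w i = 1 -> (forall i, 0 < t i) ->
  (\sum_i w i * t i) `^ (- alpha) <= \sum_i w i * t i `^ (- alpha).
Proof.
move=> al0 w0 w1 t0; set a := \sum_i w i * t i.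
have a0 : 0 < a by exact: convex_comb_gt0.
apply: (@le_trans _ _
    (\sum_i w i * (a `^ (- alpha) * (1 - alpha * (t i / a - 1))))).
  rewrite [leRHS](_ : _ =
      a `^ (- alpha) * ((1 + alpha) * \sum_i w i - alpha / a * a)).
    by rewrite w1 divfK ?gt_eqF//; lra.
  rewrite mulrBr mulrA !mulr_sumr -sumrB; apply: eq_bigr => i _.
  by field; rewrite gt_eqF.
by apply: ler_sum => i _; rewrite ler_wpM2l// powR_tangent.
Qed.

End Convexity.

(** * Diagonal entries and eigenvalues of Hermitian matrices *)

Section Spectral.
Variables (R : realType) (d : nat).
Implicit Types (A : 'M[R[i]]_d) (l : 'rV[R]_d).

Lemma hermsymmxP A : reflect (A = A ^t*) (A \is hermsymmx).
Proof.
by apply: (iffP (is_hermitianmxP _ _ _)); rewrite expr0 scale1r.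
Qed.

Lemma hermsymmx_sum (I : Type) (s : seq I) (F : I -> 'M[R[i]]_d) :
  (forall k, F k \is hermsymmx) -> \sum_(k <- s) F k \is hermsymmx.
Proof.
move=> Fh; apply/hermsymmxP/matrixP => i j; rewrite !mxE !summxE rmorph_sum/=.
apply: eq_bigr => k _; have /hermsymmxP/matrixP/(_ i j) := Fh k.
by rewrite !mxE.
Qed.

Lemma hermsymmxZ (r : R) A : A \is hermsymmx -> r%:C *: A \is hermsymmx.
Proof.
move=> /hermsymmxP/matrixP Ah; apply/hermsymmxP/matrixP => i j.
rewrite !mxE rmorphM/= {1}Ah !mxE; congr (_ * _).
by apply/esym; exact: conjc_real.
Qed.

Definition reals_mx l : 'rV[R[i]]_d := map_mx (fun x => x%:C) l.
Definition eigenvals A : 'rV[R]_d := map_mx (@complex.Re R) (spectral_diag A).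

(** The weight of the [j]-th eigenvalue in the [i]-th diagonal entry: the squared
modulus of the [i]-th coordinate of the [j]-th eigenvector, the eigenvectors
being the rows of [P]. *)
Definition weight (P : 'M[R[i]]_d) (i j : 'I_d) : R :=
  complex.Re (P j i) ^+ 2 + complex.Im (P j i) ^+ 2.

Lemma weight_ge0 P i j : 0 <= weight P i j.
Proof. by rewrite addr_ge0 ?sqr_ge0. Qed.

Lemma conj_diag_mxE P l i :
  (P ^t* *m diag_mx (reals_mx l) *m P) i i = (\sum_j weight P i j * l 0 j)%:C.
Proof.
rewrite mul_mx_diag mxE rmorph_sum/=; apply: eq_bigr => j _.
rewrite !mxE /weight; case: (P j i) => a b /=.
simpc; congr (_ +i* _); ring.
Qed.

Lemma unitary_conj1 (P : 'M[R[i]]_d) : P \is unitarymx -> P ^t* *m P = 1%:M.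
Proof.
move=> Pu; have Pu' : P ^t* \is unitarymx by rewrite trmxC_unitary.
by move/unitarymxP: Pu'; rewrite trmxCK.
Qed.

Lemma sum_weight (P : 'M[R[i]]_d) i : P \is unitarymx -> \sum_j weight P i j = 1.
Proof.
move=> /unitary_conj1 PP; have := conj_diag_mxE P (const_mx 1) i.
have -> : reals_mx (const_mx 1) = const_mx 1.
  by apply/matrixP => ? ?; rewrite !mxE.
rewrite diag_const_mx mulmx1 PP mxE eqxx => /(congr1 (@complex.Re R)) /= ->.
by apply: eq_bigr => j _; rewrite mxE mulr1.
Qed.

Lemma spectral_realE A : A \is hermsymmx ->
  A = (spectralmx A) ^t* *m diag_mx (reals_mx (eigenvals A)) *m spectralmx A.
Proof.
move=> Ah; have -> : reals_mx (eigenvals A) = spectral_diag A.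
  apply/rowP => j; rewrite !mxE RRe_real//.
  exact: (mxOverP (hermitian_spectral_diag_real Ah)).
rewrite -invmx_unitary ?spectral_unitarymx//.
exact/orthomx_spectralP/hermitian_normalmx.
Qed.

Lemma diag_hermE A i : A \is hermsymmx ->
  complex.Re (A i i) = \sum_j weight (spectralmx A) i j * eigenvals A 0 j.
Proof. by move=> Ah; rewrite {1}(spectral_realE Ah) conj_diag_mxE. Qed.

Lemma hermfun_herm f A : hermfun f A \is hermsymmx.
Proof.
apply/hermsymmxP/matrixP => i j; rewrite /hermfun !mul_mx_diag !mxE.
rewrite rmorph_sum/=; apply: eq_bigr => k _; rewrite !mxE !rmorphM/= conjCK.
have -> (r : R) : Num.conj (r%:C) = r%:C :> R[i] by exact: conjc_real.
by rewrite mulrAC [RHS]mulrAC [X in _ = X * _]mulrC.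
Qed.

Lemma row_spectralmx_eigen A j : A \is hermsymmx ->
  row j (spectralmx A) *m A = (eigenvals A 0 j)%:C *: row j (spectralmx A).
Proof.
move=> Ah; have /unitarymxP PP := spectral_unitarymx A.
rewrite -row_mul {2}(spectral_realE Ah) !mulmxA PP mul1mx mul_diag_mx.
by apply/rowP => k; rewrite !mxE.
Qed.

Lemma eigenvalue_eigenvals A j : A \is hermsymmx ->
  eigenvalue A (eigenvals A 0 j)%:C.
Proof.
move=> Ah; apply/eigenvalueP; exists (row j (spectralmx A)).
  exact: row_spectralmx_eigen.
apply/negP => /eqP P0.
have /unitarymxP/(congr1 (row j)) := spectral_unitarymx A.
rewrite row_mul P0 mul0mx => /rowP/(_ j); rewrite !mxE eqxx => /eqP.
by rewrite eq_sym oner_eq0.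
Qed.

Lemma eigenvals_le_lambda_max A j : A \is hermsymmx ->
  eigenvals A 0 j <= lambda_max A.
Proof.
move=> Ah; have d0 : (0 < d)%N by case: d j => // -[].
have [_ /(_ _ (eigenvalue_eigenvals j Ah))] := lambda_maxP d0 Ah.
by rewrite lecR.
Qed.

(** This is the Rayleigh quotient bound for a basis vector: the diagonal entry is
an average of eigenvalues. *)
Lemma diag_le_lambda_max A i : A \is hermsymmx ->
  complex.Re (A i i) <= lambda_max A.
Proof.
move=> Ah; rewrite diag_hermE//.
have Pu := spectral_unitarymx A.
rewrite -[leRHS]mul1r -(sum_weight i Pu) mulr_suml; apply: ler_sum => j _.
by rewrite ler_wpM2l ?weight_ge0// eigenvals_le_lambda_max.
Qed.

Lemma det_char_herm A (s : R) : A \is hermsymmx ->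
  \det ((s%:C)%:M - A) = (\prod_j (s - eigenvals A 0 j))%:C.
Proof.
move=> Ah; have Pu := spectral_unitarymx A; set P := spectralmx A in Pu *.
have -> : (s%:C)%:M - A =
   P ^t* *m diag_mx (reals_mx (\row_j (s - eigenvals A 0 j))) *m P.
  have -> : reals_mx (\row_j (s - eigenvals A 0 j)) =
      const_mx s%:C - reals_mx (eigenvals A).
    by apply/rowP => j; rewrite !mxE rmorphB.
  rewrite raddfB/= diag_const_mx mulmxBr mulmxBl -spectral_realE//.
  by rewrite mul_mx_scalar -scalemxAl unitary_conj1// scalemx1.
rewrite !det_mulmx mulrC mulrA -det_mulmx mulrC det_diag rmorph_prod/=.
move/unitarymxP: (Pu) => ->; rewrite det1 mulr1.
by apply: eq_bigr => j _; rewrite !mxE.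
Qed.

Lemma lambda_max_attained A : (0 < d)%N -> A \is hermsymmx ->
  exists j, lambda_max A = eigenvals A 0 j.
Proof.
move=> d0 Ah; have [/eigenvalueP[v vA v0] _] := lambda_maxP d0 Ah.
have : \det ((lambda_max A)%:C%:M - A) == 0.
  apply/det0P; exists v => //.
  by rewrite mulmxBr mul_mx_scalar vA subrr.
rewrite det_char_herm// fmorph_eq0 prodf_seq_eq0 => /hasP[j _].
by rewrite /= subr_eq0 => /eqP; exists j.
Qed.

(** A countable form of [lambda_max A <= eps], on which measurability rests.  If
all eigenvalues are at most [eps], the determinant is a product of [d] factors
that are at least [q].  Positivity of the determinant alone would not be enough
for the converse, since an eigenvalue of even multiplicity leaves no change of
sign; comparing with [q ^+ d] turns the failure at a single real point into a
failure on an open set, which contains a rational. *)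
Lemma lambda_max_leP A (eps : R) : (0 < d)%N -> A \is hermsymmx ->
  lambda_max A <= eps <->
  forall q : rat, 0 < ratr q :> R ->
    (ratr q) ^+ d <= complex.Re (\det ((eps + ratr q)%:C%:M - A)).
Proof.
move=> d0 Ah; split=> [le q q0|H].
  rewrite det_char_herm//= -[X in _ ^+ X]card_ord -prodr_const.
  apply: ler_prod => j _; rewrite ltW//=.
  by have := eigenvals_le_lambda_max j Ah; lra.
have [j lj] := lambda_max_attained d0 Ah; rewrite leNgt; apply/negP => lt.
(* [p] is the defect of the inequality, which is strictly negative at the shift
   [q0] where the determinant vanishes. *)
pose p : {poly R} :=
  \prod_k ('X - (eigenvals A 0 k - eps)%:P) - 'X^d.
have pE q : p.[q] = \prod_k (eps + q - eigenvals A 0 k) - q ^+ d.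
  rewrite hornerD hornerN hornerXn horner_prod; congr (_ - _).
  by apply: eq_bigr => k _; rewrite !hornerE; ring.
pose q0 := lambda_max A - eps.
have q0_gt0 : 0 < q0 by rewrite subr_gt0.
have pq0 : p.[q0] < 0.
  rewrite pE (bigD1 j)//= /q0 lj addrCA subrr addr0 subrr mul0r sub0r.
  by rewrite oppr_lt0 exprn_gt0// -lj.
pose O : set R := [set q | p.[q] < 0] `&` [set q | 0 < q].
have Oo : open O.
  apply: openI; last exact: open_gt.
  by apply: (open_comp _ (@open_lt R 0)) => x _; exact: continuous_horner.
have [] := @dense_rat R O; [by exists q0|by []|].
move=> y [[/= py y0] [q _ qy]]; move: py y0; rewrite -{y}qy => pq q_gt0.
have := H q q_gt0; rewrite det_char_herm//= leNgt => /negP; apply.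
by rewrite -subr_lt0 -pE.
Qed.
End Spectral.

(** * Negative powers of positive definite matrices *)

Section Psd.
Variables (R : realType) (d : nat).
Implicit Types (A : 'M[R[i]]_d).

(** Testing positivity on the [j]-th eigenvector gives nonnegativity; invertibility
excludes the value zero through the determinant. *)
Lemma psd_eigenvals_gt0 A j : psdmx A -> A \in unitmx -> 0 < eigenvals A 0 j.
Proof.
move=> [Ah Ap] Au; have Pu := spectral_unitarymx A.
rewrite lt_neqAle; apply/andP; split.
  apply: contraTN Au => /eqP e0; rewrite unitmxE (spectral_realE Ah).
  rewrite !det_mulmx det_diag (bigD1 j)//= mxE -e0 mul0r mulr0 mul0r.
  by rewrite unitr0.
have := Ap ((row j (spectralmx A)) ^t*).
rewrite trmxCK row_spectralmx_eigen// -scalemxAl mxE.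
have -> : (row j (spectralmx A) *m (row j (spectralmx A)) ^t*) 0 0 = 1.
  move/unitarymxP/matrixP/(_ j j): Pu; rewrite [X in _ = X -> _]mxE eqxx => PPjj.
  transitivity ((spectralmx A *m (spectralmx A) ^t*) j j) => //.
  by rewrite !mxE; apply: eq_bigr => k _; rewrite !mxE.
by rewrite mulr1 lecR.
Qed.

Lemma hermpow_diagE A (a : R) i : complex.Re (hermpow A a i i) =
  \sum_j weight (spectralmx A) i j * eigenvals A 0 j `^ a.
Proof.
have -> : hermpow A a = (spectralmx A) ^t* *m
    diag_mx (reals_mx (\row_j (eigenvals A 0 j `^ a))) *m spectralmx A.
  rewrite /hermpow /hermfun; congr (_ *m diag_mx _ *m _).
  by apply/rowP => j; rewrite !mxE.
by rewrite conj_diag_mxE/=; apply: eq_bigr => j _; rewrite mxE.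
Qed.

Lemma diag_posdef_gt0 A i : psdmx A -> A \in unitmx -> 0 < complex.Re (A i i).
Proof.
move=> Ap Au; rewrite diag_hermE ?Ap.1//; apply: convex_comb_gt0 => [j||j].
- exact: weight_ge0.
- exact/sum_weight/spectral_unitarymx.
- exact: psd_eigenvals_gt0.
Qed.

(** Both diagonal entries are averages, over the eigenvalues and over their powers,
with the same weights. *)
Lemma diag_hermpow_jensen A alpha i : 0 < alpha -> psdmx A -> A \in unitmx ->
  complex.Re (A i i) `^ (- alpha) <= complex.Re (hermpow A (- alpha) i i).
Proof.
move=> al0 Ap Au; rewrite diag_hermE ?Ap.1// hermpow_diagE.
apply: powR_jensen => // [j||j].
- exact: weight_ge0.
- exact/sum_weight/spectral_unitarymx.
- exact: psd_eigenvals_gt0.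
Qed.

End Psd.

(** * Expectation of a product of independent variables *)

Section Transfer.
Import HBNNSimple.
Context d d' (T : measurableType d) (T' : measurableType d') (R : realType).
Variables (mu : {measure set T -> \bar R}) (X : {mfun T >-> T'}).

(** The integral depends on [Y] only through the numbers [\int Y * \1_B (X)].  The
simple functions approximating [f] are chosen from [f] alone, so that the limit
can be compared for two different [Y]. *)
Lemma integral_mul_comp_approx (Y : T -> R) (f : T' -> R)
    (mf : measurable_fun [set: T'] (fun y => (f y)%:E)) :
  measurable_fun [set: T] Y -> (forall t, 0 <= Y t) -> (forall y, 0 <= f y) ->
  let g := nnsfun_approx measurableT mf in
  (\int[mu]_t (Y t * f (X t))%:E =
   limn (fun n => \sum_(r \in range (g n))
     r%:E * \int[mu]_t (Y t * \1_(g n @^-1` [set r]) (X t))%:E))%E.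
Proof.
move=> mY Y0 f0 g.
have mgX n : measurable_fun [set: T] (fun t => g n (X t)).
  exact: measurableT_comp.
transitivity (\int[mu]_t limn (fun n => (Y t * g n (X t))%:E))%E.
  apply: eq_integral => t _; apply/esym/cvg_lim => //.
  rewrite EFinM; under eq_fun do rewrite EFinM.
  apply: cvgeZl => //; apply: (cvg_nnsfun_approx measurableT mf) => // y _.
  by rewrite lee_fin.
rewrite monotone_convergence//; last 3 first.
- by move=> n; apply/measurable_EFinP/measurable_funM.
- by move=> n t _; rewrite lee_fin mulr_ge0.
- move=> t _ n m nm; rewrite lee_fin ler_wpM2l//.
  exact/lefP/nd_nnsfun_approx.
congr (limn _); apply/funext => n.
have mI (r : R) : measurable_fun [set: T]
    (fun t => Y t * \1_(g n @^-1` [set r]) (X t)).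
  by apply: measurable_funM => //; apply: measurableT_comp.
have gr (r : R) : r \in range (g n) -> 0 <= r.
  by rewrite inE => -[y _ <-].
transitivity (\int[mu]_t (\sum_(r \in range (g n))
    r%:E * (Y t * \1_(g n @^-1` [set r]) (X t))%:E))%E.
  apply: eq_integral => t _; rewrite fimfunE [RHS]fsumEFin//=; congr EFin.
  rewrite !fsbig_finite//= mulr_sumr.
  by apply: eq_bigr => r _; ring.
rewrite ge0_integral_fsum//=; last 2 first.
- by move=> r; apply/measurable_EFinP/measurable_funM.
- move=> r t _; rewrite -EFinM mulrCA EFinM mule_ge0 ?lee_fin//.
  exact: nnfun_muleindic_ge0.
apply: eq_fsbigr => r /gr r0; rewrite ge0_integralZl//.
- exact/measurable_EFinP.
- by move=> t _; rewrite lee_fin mulr_ge0.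
Qed.

(** A version of uniqueness of conditional expectation: two weights with the same
integrals over the sets [X @^-1` B] integrate all functions of [X] alike. *)
Lemma integral_mul_comp_ext (Y1 Y2 : T -> R) (f : T' -> R) :
  measurable_fun [set: T] Y1 -> (forall t, 0 <= Y1 t) ->
  measurable_fun [set: T] Y2 -> (forall t, 0 <= Y2 t) ->
  measurable_fun [set: T'] f -> (forall y, 0 <= f y) ->
  (forall B, measurable B ->
    \int[mu]_t (Y1 t * \1_B (X t))%:E = \int[mu]_t (Y2 t * \1_B (X t))%:E)%E ->
  (\int[mu]_t (Y1 t * f (X t))%:E = \int[mu]_t (Y2 t * f (X t))%:E)%E.
Proof.
move=> mY1 Y10 mY2 Y20 /measurable_EFinP mf f0 H.
rewrite (integral_mul_comp_approx mf mY1)// (integral_mul_comp_approx mf mY2)//.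
congr (limn _); apply/funext => n; apply: eq_fsbigr => r _.
by rewrite H.
Qed.
End Transfer.

Section Independence.
Context d (T : measurableType d) (R : realType) (P : probability T R).
Variables (I : finType) (X : I -> {RV P >-> R}).
Hypothesis indepX : mutually_independent X.

Let measurable_factor (g : R -> R) i :
  measurable_fun [set: R] g -> measurable_fun [set: T] (fun t => g (X i t)).
Proof. by move=> mh; apply: measurableT_comp. Qed.

Let integral_factor_indic i (B : set R) : measurable B ->
  (\int[P]_t (\1_B (X i t))%:E = P (X i @^-1` B))%E.
Proof.
move=> mB; transitivity (\int[P]_t (\1_(X i @^-1` B) t)%:E)%E => //.
by rewrite integral_indic ?setIT//; exact: measurable_funPTI.
Qed.

Let integral_prod_indic (B : I -> set R) : (forall i, measurable (B i)) ->
  (\int[P]_t (\prod_i \1_(B i) (X i t))%:E =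
   \prod_i \int[P]_t (\1_(B i) (X i t))%:E)%E.
Proof.
move=> mB; under [RHS]eq_bigr do rewrite integral_factor_indic//.
transitivity (\prod_(i in [set: I]%SET) P (X i @^-1` B i))%E; last first.
  by apply: eq_bigl => i; rewrite inE.
rewrite -(indepX [set: I]%SET mB); set E := \bigcap_(i in _) _.
have mE : measurable E.
  apply: fin_bigcap_measurable => // i _; exact: measurable_funPTI.
rewrite -[in RHS](setIT E) -integral_indic//; apply: eq_integral => t _.
congr EFin; rewrite indicE; case: (boolP (t \in E)) => [/set_mem tE|tE].
  by rewrite big1// => i _; rewrite indicE mem_set//; apply: tE; rewrite /= inE.
apply/eqP; rewrite prodf_seq_eq0; apply: contraNT tE => /hasPn H.
apply/mem_set => i _; have := H i (mem_index_enum i).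
by rewrite /= indicE; case: (boolP (_ \in _)) => [/set_mem//|_]; rewrite eqxx.
Qed.

(** The product rule on events is the case where all [h i] are indicators.  They
are exchanged for general functions one index of [s] at a time: with the other
factors kept as a weight [Y], the induction hypothesis says that [Y] has the same
integrals over the events [X a @^-1` B] as the constant [c], and
[integral_mul_comp_ext] extends this from indicators to [h a]. *)
Let integral_prod_seq (s : seq I) : forall (h : I -> R -> R),
  (forall i, measurable_fun [set: R] (h i)) -> (forall i y, 0 <= h i y) ->
  (forall i, \int[P]_t (h i (X i t))%:E < +oo)%E ->
  (forall i, i \notin s -> exists2 B, measurable B & h i = \1_B) ->
  (\int[P]_t (\prod_i h i (X i t))%:E = \prod_i \int[P]_t (h i (X i t))%:E)%E.
Proof.
elim: s => [|a s IH] h mh h0 hfin hB.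
  have /choice[B HB] i : exists B, measurable B /\ h i = \1_B.
    by have [B mB hE] := hB i isT; exists B.
  transitivity (\int[P]_t (\prod_i \1_(B i) (X i t))%:E)%E.
    apply: eq_integral => t _; congr EFin; apply: eq_bigr => i _.
    by rewrite (HB i).2.
  rewrite integral_prod_indic => [|i]; last exact: (HB i).1.
  by apply: eq_bigr => i _; rewrite (HB i).2.
pose Y t := \prod_(i | i != a) h i (X i t).
pose c := (\prod_(i | i != a) \int[P]_t (h i (X i t))%:E)%E.
have mY : measurable_fun [set: T] Y.
  rewrite /Y; under eq_fun do rewrite -big_filter.
  by apply: measurable_prod => i _; exact: measurable_factor.
have Y0 t : 0 <= Y t by apply: prodr_ge0.
have int_ge0 i : (0 <= \int[P]_t (h i (X i t))%:E)%E.
  by apply: integral_ge0 => t _; rewrite lee_fin.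
have c0 : (0 <= c)%E by apply: prode_ge0.
have cfin : c \is a fin_num.
  apply: prode_fin_num => i _; rewrite ge0_fin_numE//.
transitivity (\int[P]_t (Y t * h a (X a t))%:E)%E.
  by apply: eq_integral => t _; rewrite (bigD1 a)//= mulrC.
rewrite (@integral_mul_comp_ext _ _ _ _ _ _ (X a) Y (cst (fine c)) (h a))//;
    last first.
- move=> B mB.
  pose h' i := if i == a then \1_B else h i.
  have h'a : h' a = \1_B by rewrite /h' eqxx.
  have h'N i : i != a -> h' i = h i by rewrite /h' => /negbTE->.
  have mh' i : measurable_fun [set: R] (h' i).
    by rewrite /h'; case: eqP => // _; exact: measurable_indic.
  have h'0 i y : 0 <= h' i y by rewrite /h'; case: eqP.
  have h'fin i : (\int[P]_t (h' i (X i t))%:E < +oo)%E.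
    rewrite /h'; case: eqP => // _; rewrite integral_factor_indic//.
    by rewrite -ge0_fin_numE// fin_num_measure//; exact: measurable_funPTI.
  have h'B i : i \notin s -> exists2 C, measurable C & h' i = \1_C.
    rewrite /h'; case: eqP => [_ _|/eqP ia is_]; first by exists B.
    by apply: hB; rewrite inE negb_or ia.
  transitivity (\int[P]_t (\prod_i h' i (X i t))%:E)%E.
    apply: eq_integral => t _; rewrite (bigD1 a)//= mulrC h'a; congr (_ * _)%:E.
    by apply: eq_bigr => i ia; rewrite h'N.
  rewrite IH// (bigD1 a)//= h'a muleC.
  under eq_bigr => i ia do rewrite h'N//.
  rewrite -/c -[in LHS](fineK cfin) -ge0_integralZl//.
  + exact/measurable_EFinP/measurable_factor/measurable_indic.
  + by rewrite lee_fin fine_ge0.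
- by move=> t; exact: fine_ge0.
rewrite (bigD1 a)//= -/c muleC -[in RHS](fineK cfin) -ge0_integralZl//.
- exact/measurable_EFinP/measurable_factor.
- by move=> t _; rewrite lee_fin.
- by rewrite lee_fin fine_ge0.
Qed.

Lemma indep_integral_prod (h : I -> R -> R) :
  (forall i, measurable_fun [set: R] (h i)) -> (forall i y, 0 <= h i y) ->
  (forall i, \int[P]_t (h i (X i t))%:E < +oo)%E ->
  (\int[P]_t (\prod_i h i (X i t))%:E = \prod_i \int[P]_t (h i (X i t))%:E)%E.
Proof.
move=> mh h0 hfin; apply: (integral_prod_seq (s := enum I)) => // i.
by rewrite mem_enum.
Qed.
End Independence.

(** * Measurability of the largest eigenvalue *)

Section ComplexMeasurable.
Context disp (T : measurableType disp) (R : realType).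
Implicit Types f g : T -> R[i].

Definition cmeasurable f :=
  measurable_fun [set: T] (fun t => complex.Re (f t)) /\
  measurable_fun [set: T] (fun t => complex.Im (f t)).

Lemma cmeasurable_cst (z : R[i]) : cmeasurable (fun=> z).
Proof. by split. Qed.

Lemma cmeasurable_real (f : T -> R) : measurable_fun [set: T] f ->
  cmeasurable (fun t => (f t)%:C).
Proof. by split. Qed.

Lemma cmeasurableD f g : cmeasurable f -> cmeasurable g ->
  cmeasurable (fun t => f t + g t).
Proof.
move=> [f1 f2] [g1 g2]; split.
  under eq_fun do rewrite raddfD; exact: measurable_funD.
under eq_fun do rewrite raddfD; exact: measurable_funD.
Qed.

Lemma cmeasurableM f g : cmeasurable f -> cmeasurable g ->
  cmeasurable (fun t => f t * g t).
Proof.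
move=> [f1 f2] [g1 g2]; split.
  rewrite (_ : (fun t => _) = fun t => complex.Re (f t) * complex.Re (g t) -
      complex.Im (f t) * complex.Im (g t)).
    by apply: measurable_funB; exact: measurable_funM.
  by apply/funext => t; case: (f t) (g t) => [a b] [].
rewrite (_ : (fun t => _) = fun t => complex.Re (f t) * complex.Im (g t) +
    complex.Im (f t) * complex.Re (g t)).
  by apply: measurable_funD; exact: measurable_funM.
by apply/funext => t; case: (f t) (g t) => [a b] [].
Qed.

Lemma cmeasurable_sum (I : Type) (s : seq I) (f : I -> T -> R[i]) :
  (forall i, cmeasurable (f i)) -> cmeasurable (fun t => \sum_(i <- s) f i t).
Proof.
move=> mf; elim: s => [|i s IH].
  by under eq_fun do rewrite big_nil; exact: cmeasurable_cst.
by under eq_fun do rewrite big_cons; exact: cmeasurableD.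
Qed.

Lemma cmeasurable_prod (I : Type) (s : seq I) (f : I -> T -> R[i]) :
  (forall i, cmeasurable (f i)) -> cmeasurable (fun t => \prod_(i <- s) f i t).
Proof.
move=> mf; elim: s => [|i s IH].
  by under eq_fun do rewrite big_nil; exact: cmeasurable_cst.
by under eq_fun do rewrite big_cons; exact: cmeasurableM.
Qed.

Lemma cmeasurable_det n (M : T -> 'M[R[i]]_n) :
  (forall i j, cmeasurable (fun t => M t i j)) ->
  cmeasurable (fun t => \det (M t)).
Proof.
move=> mM; apply: cmeasurable_sum => s; apply: cmeasurableM.
  exact: cmeasurable_cst.
exact: cmeasurable_prod.
Qed.

Lemma measurable_lambda_max_le n (M : T -> 'M[R[i]]_n) (eps : R) : (0 < n)%N ->
  (forall t, M t \is hermsymmx) -> (forall i j, cmeasurable (fun t => M t i j)) ->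
  measurable [set t | lambda_max (M t) <= eps].
Proof.
move=> n0 hM mM.
pose D (q : rat) t := complex.Re (\det ((eps + ratr q)%:C%:M - M t)).
(* The rationals are enumerated by [unpickle]; a [k] that codes none of them
   contributes the whole space. *)
pose F k := [set t | forall q : rat, unpickle k = Some q ->
  0 < ratr q :> R -> (ratr q) ^+ n <= D q t].
rewrite (_ : [set t | _] = \bigcap_k F k); last first.
  apply/seteqP; split=> t /=.
    by move=> /(lambda_max_leP _ n0 (hM t)) H k _ q _; exact: H.
  move=> H; apply/(lambda_max_leP _ n0 (hM t)) => q q0.
  by apply: (H (pickle q) I q) => //; rewrite pickleK.
apply: bigcapT_measurable => k; rewrite /F.
case: (unpickle k) => [q|]; last first.
  by rewrite (_ : [set t | _] = setT)//; apply/seteqP; split.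
have [q0|q0] := boolP (0 < ratr q :> R); last first.
  rewrite (_ : [set t | _] = setT)//; apply/seteqP; split => // t _ r [<-] r0.
  by rewrite r0 in q0.
rewrite (_ : [set t | _] = setT `&` [set t | (ratr q) ^+ n <= D q t]).
  apply: measurable_fun_le => //.
  have [] // := @cmeasurable_det n (fun t => (eps + ratr q)%:C%:M - M t).
  move=> i j; under eq_fun do rewrite !mxE -mulN1r.
  by apply: cmeasurableD; [|apply: cmeasurableM]; try exact: cmeasurable_cst.
rewrite setTI; apply/seteqP; split => t /=; first by apply.
by move=> H r [<-].
Qed.
End ComplexMeasurable.

(** * Small ball probabilities of weighted sums *)

Lemma lee_prod_ge0 (R : realType) (I : Type) (s : seq I) (f g : I -> \bar R) :
  (forall i, 0 <= f i)%E -> (forall i, f i <= g i)%E ->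
  (\prod_(i <- s) f i <= \prod_(i <- s) g i)%E.
Proof.
move=> f0 fg; elim: s => [|i s IH]; first by rewrite !big_nil.
by rewrite !big_cons; apply: lee_pmul => //; exact: prode_ge0.
Qed.

Section SmallBall.
Context (R : realType) (disp : measure_display) (T : measurableType disp).
Variables (P : probability T R) (K : nat) (x : 'I_K -> {RV P >-> R}).
Variables (C alpha : R).
Hypothesis indep : mutually_independent x.
Hypothesis laplace : forall (theta : R) (k : 'I_K), 0 < theta ->
  ('E_P[fun w => expR (- theta * x k w)] <= (C * theta `^ (- alpha))%:E)%E.

Lemma measurable_weighted_sum (a : 'I_K -> R) :
  measurable_fun [set: T] (fun w => \sum_k a k * x k w).
Proof. by apply: measurable_sum => k; exact: measurable_funM. Qed.

(** Chernoff's bound: on the event, [theta * eps - theta * \sum_k a k * x k] is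
nonnegative, so its exponential dominates the indicator. *)
Lemma prob_weighted_sum_le_laplace (a : 'I_K -> R) (theta eps : R) :
  (forall k, 0 < a k) -> 0 < theta ->
  (P [set w | (\sum_k a k * x k w <= eps)%R] <=
    (expR (theta * eps) * \prod_k (C * (theta * a k) `^ (- alpha)))%:E)%E.
Proof.
move=> a0 th0; set S := [set w | _].
have mS : measurable S.
  rewrite -[S]setTI; apply: measurable_fun_le => //.
  exact: measurable_weighted_sum.
pose h k y := expR (- (theta * a k) * y).
have mh k : measurable_fun [set: R] (h k).
  by apply: measurableT_comp => //; exact: measurable_funM.
have mhx k : measurable_fun [set: T] (fun w => h k (x k w)).
  by apply: measurableT_comp.
have lh k : (\int[P]_w (h k (x k w))%:E <= (C * (theta * a k) `^ (- alpha))%:E)%E.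
  have := laplace k (mulr_gt0 th0 (a0 k)).
  (* The expectation is a locked integral. *)
  by rewrite unlock.
have mprod : measurable_fun [set: T] (fun w => \prod_k h k (x k w)).
  by apply: measurable_prod.
have prod0 w : 0 <= \prod_k h k (x k w).
  by apply: prodr_ge0 => k _; exact: expR_ge0.
rewrite -[S]setIT -integral_indic//.
apply: (@le_trans _ _
    (\int[P]_w ((expR (theta * eps))%:E * (\prod_k h k (x k w))%:E))%E).
  apply: ge0_le_integral => //.
  - exact/measurable_EFinP/measurable_indic.
  - by apply: measurable_funeM; exact/measurable_EFinP.
  - move=> w _; rewrite -EFinM lee_fin indicE.
    case: (boolP (w \in S)) => [/set_mem wS|_]; last first.
      by rewrite mulr_ge0// expR_ge0.
    rewrite /h -expR_sum -expRD -expR0 ler_expR.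
    have -> : \sum_k - (theta * a k) * x k w = - (theta * \sum_k a k * x k w).
      by rewrite mulr_sumr -sumrN; apply: eq_bigr => k _; ring.
    by rewrite subr_ge0 ler_pM2l.
rewrite ge0_integralZl//; last 2 first.
- exact/measurable_EFinP.
- by move=> w _; rewrite lee_fin.
rewrite EFinM lee_wpmul2l ?lee_fin ?expR_ge0//.
rewrite (indep_integral_prod indep)//.
- rewrite -prodEFin; apply: lee_prod_ge0 => // k.
  by apply: integral_ge0 => w _; rewrite lee_fin expR_ge0.
- by move=> k y; exact: expR_ge0.
- by move=> k; apply: le_lt_trans (lh k) _; rewrite ltry.
Qed.

Lemma prob_weighted_sum_le (a : 'I_K -> R) (eps : R) :
  (0 < K)%N -> 0 < alpha -> (forall k, 0 < a k) -> 0 < eps ->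
  (P [set w | (\sum_k a k * x k w <= eps)%R] <=
    ((expR 1 * eps / (K%:R * alpha)) `^ (alpha * K%:R) * C ^+ K *
       \prod_k a k `^ (- alpha))%:E)%E.
Proof.
move=> K0 alpha0 a0 eps0; have K0' : 0 < K%:R :> R by rewrite ltr0n.
(* This minimizes [expR (theta * eps) * theta `^ (- (K%:R * alpha))]. *)
pose theta := K%:R * alpha / eps.
have th0 : 0 < theta by rewrite !(mulr_gt0, invr_gt0).
apply: le_trans (prob_weighted_sum_le_laplace eps a0 th0) _.
rewrite lee_fin.
under eq_bigr => k _ do rewrite (powRM _ (ltW th0) (ltW (a0 k))).
rewrite !big_split/= !prodr_const card_ord !mulrA.
rewrite le_eqVlt; apply/orP; left; apply/eqP; congr (_ * _).
rewrite -(powR_mulrn _ (powR_ge0 theta (- alpha))) -powRrM mulrAC; congr (_ * _).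
have -> : expR 1 * eps / (K%:R * alpha) = expR 1 * theta^-1.
  by rewrite /theta; field; rewrite !gt_eqF.
rewrite powRM ?expR_ge0 ?invr_ge0 ?ltW// -expRM mul1r.
congr (expR _ * _); first by rewrite /theta divfK ?gt_eqF// mulrC.
by rewrite /powR invr_eq0 gt_eqF// lnV ?posrE//; congr expR; ring.
Qed.
End SmallBall.

Theorem theorem3p3 (R : realType) (disp : measure_display)
    (T : measurableType disp) (P : probability T R)
    (d K : nat) (hd : (0 < d)%N) (hK : (0 < K)%N)
    (A : 'I_K -> 'M[R[i]]_d) (x : 'I_K -> {RV P >-> R})
    (hpsd : forall k, psdmx (A k)) (hinv : forall k, A k \in unitmx)
    (hindep : mutually_independent x)
    (C alpha : R) (hC : 0 < C) (halpha : 0 < alpha)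
    (hlap : forall (theta : R) (k : 'I_K), 0 < theta ->
      ('E_P[fun w => expR (- theta * x k w)]
         <= (C * theta `^ (- alpha))%:E)%E) :
  let e : R := expR 1 in
  let nu : R := lambda_max (\sum_(k < K) hermpow (A k) (- alpha)) in
  let nuk : 'I_K -> R := fun k => lambda_max (hermpow (A k) (- alpha)) in
  (forall eps : R, 0 < eps ->
     eps < K%:R * alpha / e * (K%:R / (C * nu)) `^ (alpha^-1) ->
     (P [set w | (lambda_max (\sum_(k < K) (x k w)%:C *: A k) <= eps)%R]
        <= ((e * eps / (K%:R * alpha)) `^ (alpha * K%:R)
              * (C * nu / K%:R) ^+ K)%:E)%E)
  /\
  (forall eps : R, 0 < eps ->
     eps < alpha / e * C `^ (- alpha^-1)
             * (\prod_(k < K) nuk k) `^ (- (alpha * K%:R)^-1) ->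
     (P [set w | (lambda_max (\sum_(k < K) (x k w)%:C *: A k) <= eps)%R]
        <= ((\prod_(k < K) nuk k) * C ^+ K
              * (e * eps / alpha) `^ (K%:R * alpha))%:E)%E).
Proof.
move=> e nu nuk.
pose i0 : 'I_d := Ordinal hd.
pose a k := complex.Re (A k i0 i0).
have a0 k : 0 < a k by exact: diag_posdef_gt0.
have Ah k : A k \is hermsymmx by have [] := hpsd k.
have jensen k : a k `^ (- alpha) <= complex.Re (hermpow (A k) (- alpha) i0 i0).
  exact: diag_hermpow_jensen.
(* Both bounds follow from this one, by two estimates of the last product. *)
have small_ball (eps : R) : 0 < eps ->
  (P [set w | (lambda_max (\sum_(k < K) (x k w)%:C *: A k) <= eps)%R] <=
    ((e * eps / (K%:R * alpha)) `^ (alpha * K%:R) * C ^+ K *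
       \prod_k a k `^ (- alpha))%:E)%E.
  move=> eps0.
  apply: le_trans (prob_weighted_sum_le hindep hlap hK halpha a0 eps0).
  have Mh w : \sum_(k < K) (x k w)%:C *: A k \is hermsymmx.
    by apply: hermsymmx_sum => k; exact: hermsymmxZ.
  apply: le_measure.
  - rewrite inE; apply: measurable_lambda_max_le => // i j.
    under eq_fun do rewrite summxE.
    apply: cmeasurable_sum => k; under eq_fun do rewrite mxE.
    apply: cmeasurableM; last exact: cmeasurable_cst.
    exact: cmeasurable_real.
  - rewrite inE -[X in measurable X]setTI; apply: measurable_fun_le => //.
    exact: measurable_weighted_sum.
  - move=> w /=; apply: le_trans; apply: le_trans (diag_le_lambda_max i0 (Mh w)).
    rewrite summxE raddf_sum/= le_eqVlt; apply/orP; left; apply/eqP.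
    apply: eq_bigr => k _; rewrite mxE /a; case: (A k i0 i0) => r s /=.
    by rewrite mul0r subr0 mulrC.
have pow_ge0 (eps : R) : 0 < eps -> 0 <= e * eps / (K%:R * alpha).
  move=> eps0.
  by rewrite divr_ge0// mulr_ge0 ?expR_ge0 ?(ltW eps0) ?(ltW halpha).
split=> eps eps0 _; apply: le_trans (small_ball eps eps0) _; rewrite lee_fin.
  rewrite -mulrA ler_wpM2l ?powR_ge0// -mulrA exprMn.
  rewrite ler_wpM2l ?exprn_ge0 ?(ltW hC)//.
  have := @leif_AGM R 'I_K xpredT (fun k => a k `^ (- alpha)).
  rewrite cardT size_enum_ord => /(_ (fun k _ => powR_ge0 _ _))[agm _].
  apply: (le_trans agm).
  have sum_ge0 : 0 <= \sum_k a k `^ (- alpha).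
    by apply: sumr_ge0 => k _; exact: powR_ge0.
  have sum_le : \sum_k a k `^ (- alpha) <= nu.
    have Hh : \sum_(k < K) hermpow (A k) (- alpha) \is hermsymmx.
      by apply: hermsymmx_sum => k; exact: hermfun_herm.
    apply: le_trans (diag_le_lambda_max i0 Hh).
    by rewrite summxE raddf_sum; apply: ler_sum => k _; exact: jensen.
  have div_le : (\sum_k a k `^ (- alpha)) / K%:R <= nu / K%:R.
    by rewrite ler_wpM2r// invr_ge0.
  apply: lerXn2r => //; rewrite nnegrE; first exact: divr_ge0.
  by rewrite divr_ge0// (le_trans sum_ge0).
have nuk_ge k : a k `^ (- alpha) <= nuk k.
  exact: le_trans (jensen k) (diag_le_lambda_max i0 (hermfun_herm _ _)).
have prod_le : \prod_k a k `^ (- alpha) <= \prod_k nuk k.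
  by apply: ler_prod => k _; rewrite powR_ge0 nuk_ge.
have base_le : e * eps / (K%:R * alpha) <= e * eps / alpha.
  rewrite ler_wpM2l ?mulr_ge0 ?expR_ge0 ?(ltW eps0)//.
  rewrite lef_pV2 ?posrE ?mulr_gt0 ?ltr0n//.
  by rewrite ler_peMl ?(ltW halpha)// ler1n.
rewrite -mulrA [leRHS]mulrC [_ * C ^+ K]mulrC [alpha * K%:R]mulrC.
apply: ler_pM.
- exact: powR_ge0.
- by rewrite mulr_ge0 ?exprn_ge0 ?(ltW hC)// prodr_ge0// => k _; exact: powR_ge0.
- apply: ge0_ler_powR => //.
  + by rewrite mulr_ge0 ?(ltW halpha).
  + exact: pow_ge0.
  + by rewrite nnegrE (le_trans (pow_ge0 eps eps0)).
- by rewrite ler_wpM2l// exprn_ge0 ?(ltW hC).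
Qed.
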